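(* Let $X$ be a locally finite, connected graph (multiple edges and loops allowed) in which every vertex has degree at least $2$, let $E(X)$ be its set of oriented edges, and let $q^{(n)}(x,y)$ be the $n$-step probabilities of non-backtracking random walk on $X$. (a) If $X$ is finite, then for all $x,y\in X$, $$\lim_{n\to\infty}\frac1n\Bigl(q^{(1)}(x,y)+q^{(2)}(x,y)+\dots+q^{(n)}(x,y)\Bigr)=\frac{\deg(y)}{|E(X)|}.$$ (b) If $X$ is finite and every vertex has degree at least $3$, then for all $x,y\in X$: $$\lim_{n\to\infty}q^{(n)}(x,y)=\frac{\deg(y)}{|E(X)|}\quad\text{if } X \text{ is not bipartite},$$ $$\lim_{n\to\infty}q^{(2n+\delta)}(x,y)=\frac{2\deg(y)}{|E(X)|}\quad\text{if } X \text{ is bipartite},$$ where $\delta=0$ if the graph distance between $x$ and $y$ is even and $\delta=1$ if it is odd. (c) If $X$ is infinite, then for all $x,y\in X$, $\lim_{n\to\infty}q^{(n)}(x,y)=0$.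
   Context: $X$ denotes both the graph and its vertex set. For vertices $x\neq y$, $e(x,y)$ is the number of edges between $x$ and $y$; $e(x,x)$ is twice the number of loops at $x$; $\deg(x)=\sum_y e(x,y)$. To each unoriented edge (including each loop) one associates two oppositely oriented edges $e,\check e$ with $\check{\check e}=e$, $e\ne\check e$; $E=E(X)$ is the set of all oriented edges, so $|E(X)|$ is twice the number of unoriented edges. $e^-$ and $e^+$ are the initial and terminal vertices of $e$, so $(\check e)^-=e^+$ and $(\check e)^+=e^-$. Write $e\to f$ if $f^-=e^+$ and $f\neq\check e$. Non-backtracking random walk (NBRW): starting at a vertex $x$, the walker chooses uniformly one of the $\deg(x)$ oriented edges with initial vertex $x$ and moves to its terminal vertex; thereafter, having just traversed $e$, he chooses uniformly among the $\deg(e^+)-1$ oriented edges $f$ with $e\to f$ and moves to $f^+$. $q^{(n)}(x,y)$ is the probability that the walker starting at $x$ is at $y$ at the $n$-th step. Equivalently, with $Q_E=(q_E(e,f))_{e,f\in E}$, $q_E(e,f)=1/(\deg(e^+)-1)$ if $e\to f$ and $0$ otherwise, and $q_E^{(n)}(e,f)$ the entries of $Q_E^n$ ($Q_E^0$ = identity), one has $q^{(n)}(x,y)=\frac1{\deg(x)}\sum_{e^+=x,\,f^+=y}q_E^{(n)}(e,f)$. *)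

(* Defs.v *)
From HB Require Import structures.
From mathcomp Require Import all_boot all_order all_algebra.
From mathcomp Require Import finmap.
From mathcomp Require Import all_classical all_reals all_analysis.

Set Implicit Arguments.
Unset Strict Implicit.
Unset Printing Implicit Defensive.
Import Order.TTheory GRing.Theory Num.Theory numFieldNormedType.Exports.
Local Open Scope classical_set_scope.
Local Open Scope ring_scope.

(* A graph with multiple edges and loops is given by its vertices and its
   oriented edges.  The orientation reversal [erev] has no fixed point, so
   every unoriented edge, loops included, is a pair {e, erev e} of two distinct
   oriented edges. *)
Record multigraph := Multigraph {
  vertex :> choiceType;
  oedge : choiceType;
  einit : oedge -> vertex;
  eterm : oedge -> vertex;
  erev : oedge -> oedge;
  erevK : involutive erev;
  erev_neq : forall e, erev e != e;
  einit_rev : forall e, einit (erev e) = eterm e }.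

Lemma eterm_rev (X : multigraph) (e : oedge X) : eterm (erev e) = einit e.
Proof. by rewrite -einit_rev erevK. Qed.

Section Graph.
Variable X : multigraph.
Implicit Types (x y : X) (e f : oedge X).

Definition out_edges x : set (oedge X) := [set e | einit e = x].
Definition in_edges x : set (oedge X) := [set e | eterm e = x].

Definition locally_finite_graph := forall x, finite_set (out_edges x).

(* Counting oriented edges from x to y counts each unoriented edge between
   x and y once if x != y, and each loop twice if x = y. *)
Definition nedges x y : nat :=
  #|` fset_set (out_edges x `&` in_edges y)|%fset.

Definition deg x : nat := \sum_(y \in [set: X]) nedges x y.

(* |E(X)|, meaningful when there are finitely many oriented edges *)
Definition num_oedges : nat := #|` fset_set [set: oedge X]|%fset.

Fixpoint is_walk x (s : seq (oedge X)) y : Prop :=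
  if s is e :: s' then einit e = x /\ is_walk (eterm e) s' y else x = y.

Definition connected_graph := forall x y, exists s, is_walk x s y.

Definition has_walk x y (n : nat) := exists s, size s = n /\ is_walk x s y.

(* minimal length of a walk from x to y (0 by convention if there is none) *)
Definition gdist x y : nat :=
  match pselect (exists n, `[< has_walk x y n >]) with
  | left h => ex_minn h
  | right _ => 0
  end.

Definition bipartite_graph :=
  exists c : X -> bool, forall e, c (einit e) != c (eterm e).

Definition nb_next e f : bool := (einit f == eterm e) && (f != erev e).

End Graph.

Section NBRW.
Variables (R : realType) (X : multigraph).
Implicit Types (x y : X) (e f : oedge X).

Definition qE e f : R :=
  if nb_next e f then ((deg (eterm e))%:R - 1)^-1 else 0.

(* Entries of the powers of the matrix qE.  The sum is finitely supported when
   X is locally finite. *)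
Fixpoint qEn (n : nat) e f : R :=
  if n is m.+1 then \sum_(g \in [set: oedge X]) qE e g * qEn m g f
  else (e == f)%:R.

(* The first step picks e uniformly among the edges leaving x, and the
   remaining n steps follow qE. *)
Definition nbrw (n : nat) x y : R :=
  if n is m.+1 then
    \sum_(e \in out_edges x) \sum_(f \in in_edges y) (deg x)%:R^-1 * qEn m e f
  else (x == y)%:R.

End NBRW.

Section Consistency.
Variables (R : realType) (X : multigraph).
Hypothesis X_lf : locally_finite_graph X.
Implicit Types (x y : X) (e f : oedge X).

Lemma in_edgesE x : in_edges x = (@erev X) @` out_edges x.
Proof.
apply/seteqP; split => e /=.
  by move=> ex; exists (erev e); [rewrite /out_edges /= einit_rev|rewrite erevK].
by case=> f fx <-; rewrite /in_edges /= eterm_rev.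
Qed.

Lemma finite_in_edges x : finite_set (in_edges x).
Proof. by rewrite in_edgesE; apply: finite_image. Qed.

Lemma deg_card x : deg x = #|` fset_set (out_edges x)|%fset.
Proof.
pose s : seq (oedge X) := fset_set (out_edges x).
have sE e : (e \in s) = (einit e == x).
  rewrite /s in_fset_set //; apply/idP/eqP; first by move/set_mem.
  by move=> ex; apply/mem_set.
have nE y : nedges x y = count (fun e => eterm e == y) s.
  rewrite -size_filter; apply: perm_size; apply: uniq_perm.
  - exact: fset_uniq.
  - by rewrite filter_uniq // fset_uniq.
  move=> e; rewrite in_fset_set; last exact: finite_setIl.
  rewrite mem_filter sE; apply/idP/andP.
    by move/set_mem => [ex ey]; split; apply/eqP.
  by case=> /eqP ey /eqP ex; apply/mem_set.
rewrite /deg (@fsbigE _ _ _ _ _ (undup (map (@eterm X) s))) //.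
- rewrite (eq_bigl xpredT); last by move=> y; rewrite in_setT.
  rewrite (eq_bigr (fun y => \sum_(e <- s) (eterm e == y : nat)%R)); last first.
    by move=> y _; rewrite nE -big_mkcond sum1_count.
  rewrite exchange_big /= -[RHS]sum1_size; apply: eq_big_seq => e es.
  have := count_uniq_mem (eterm e) (undup_uniq (map (@eterm X) s)).
  rewrite mem_undup map_f // => eS; rewrite -[RHS]eS.
  rewrite -sum1_count [RHS]big_mkcond /=; apply: eq_bigr => y _.
  by rewrite eq_sym.
- exact: undup_uniq.
- move=> y _; rewrite mem_undup nE => yP; apply/eqP; rewrite -leqn0 leqNgt -has_count.
  apply/hasPn => e es; apply: contra yP => /eqP <-; exact: map_f.
Qed.

Lemma nb_next_setE (g : oedge X) :
  in_edges (einit g) `&` [set e | nb_next e g] =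
  in_edges (einit g) `\` [set erev g].
Proof.
apply/seteqP; split => e /= [eg].
  case/andP => _ ge; split=> // ee.
  by move: ge; rewrite ee erevK eqxx.
move=> ee; split=> //; apply/andP; split; first by apply/eqP; rewrite -eg.
by apply/eqP => gE; apply: ee; rewrite gE erevK.
Qed.

(* qE is doubly stochastic: its columns sum to 1 as well. *)
Lemma qE_col (g : oedge X) : (2 <= deg (einit g))%N ->
  \sum_(e \in in_edges (einit g)) qE R e g = 1.
Proof.
move=> dg; set x := einit g.
have fin_x := finite_in_edges x.
pose c : R := ((deg x)%:R - 1)^-1.
rewrite (eq_fsbigr (fun e => if e \in [set e | nb_next e g] then c else 0));
  last first.
  move=> e /set_mem ex; rewrite /qE.
  have -> : (e \in [set e | nb_next e g]) = nb_next e g.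
    by apply/idP/idP => [/set_mem|] // H; apply/mem_set.
  by rewrite /c -ex.
rewrite -fsbig_mkcondr nb_next_setE fsbig_finite; last exact: finite_setD.
rewrite big_const_seq count_predT iter_addr_0 -mulr_natl.
have -> : size (fset_set (in_edges x `\` [set erev g])) = (deg x).-1.
  rewrite fset_setD1 // deg_card.
  have -> : #|` fset_set (out_edges x)|%fset = #|` fset_set (in_edges x)|%fset.
    rewrite in_edgesE fset_set_image // card_imfset //.
    exact: inv_inj (@erevK X).
  have := cardfsD1 (erev g) (fset_set (in_edges x)).
  rewrite in_fset_set // mem_set; last by rewrite /in_edges /= eterm_rev.
  by move=> ->.
rewrite /c -subn1 natrB; last exact: ltnW.
by rewrite mulfV // subr_eq0 pnatr_eq1; case: eqP dg => // ->.
Qed.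

Lemma nbrwE n x y : (2 <= deg x)%N ->
  nbrw R n x y =
  (deg x)%:R^-1 * \sum_(e \in in_edges x) \sum_(f \in in_edges y) qEn R n e f.
Proof.
move=> dx; have fin_in := finite_in_edges.
case: n => [|n] /=.
  rewrite (eq_fsbigr (fun=> (x == y)%:R)); last first.
    move=> e /set_mem ex; case: eqP => [<-|xy].
      rewrite (fsbigD1 e) //= eqxx fsbig1 ?addr0 // => f [_ /= fe].
      by case: eqP => // ef; case: fe.
    rewrite fsbig1 // => f /= fy; case: eqP => // ef.
    by case: xy; rewrite -ex -fy ef.
  rewrite fsbig_finite // big_const_seq count_predT iter_addr_0.
  rewrite -[X in _ * X]mulr_natl.
  have -> : size (fset_set (in_edges x)) = deg x.
    rewrite deg_card in_edgesE fset_set_image // card_imfset //.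
    exact: inv_inj (@erevK X).
  by rewrite mulrA mulVf ?mul1r // pnatr_eq0 -lt0n ltnW.
have step e f : in_edges x e -> \sum_(g \in [set: oedge X]) qE R e g * qEn R n g f
    = \sum_(g \in out_edges x) qE R e g * qEn R n g f.
  move=> ex; apply/esym/fsbig_widen => // g [_ /= gx].
  rewrite /qE /nb_next; case: eqP => [ge|_] /=; last by rewrite mul0r.
  by case: gx; rewrite /out_edges /= ge.
rewrite [in RHS](eq_fsbigr (fun e => \sum_(g \in out_edges x)
    \sum_(f \in in_edges y) qE R e g * qEn R n g f)); last first.
  move=> e /set_mem ex; rewrite [RHS]exchange_fsbig //.
  by apply: eq_fsbigr => f _; exact: step.
rewrite [in RHS]exchange_fsbig // mulr_fsumr; apply: eq_fsbigr => g /set_mem gx.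
rewrite [in RHS]exchange_fsbig // mulr_fsumr; apply: eq_fsbigr => f _.
rewrite -mulr_fsuml -gx qE_col ?mul1r ?gx //.
Qed.

End Consistency.

(* Main.v *)
Require Import Defs.
From HB Require Import structures.
From mathcomp Require Import all_boot all_order all_algebra.
From mathcomp Require Import finmap.
From mathcomp Require Import all_classical all_reals all_analysis.
From mathcomp Require Import ring lra zify.

Set Implicit Arguments.
Unset Strict Implicit.
Unset Printing Implicit Defensive.
Import Order.TTheory GRing.Theory Num.Theory numFieldNormedType.Exports.
Local Open Scope classical_set_scope.
Local Open Scope ring_scope.

(** Let [hit n e] be the probability that a walk which has just traversed [e] is
    at [y] after [n] further steps. Then [hit n] is the [n]-th iterate of the
    operator [step] given by the matrix [qE], started from the indicator of the
    edges that end at [y], and [nbrw n x y] is the average of [hit n] over the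
    edges that end at [x]. The matrix is doubly stochastic, so [hit n] has total
    mass [deg y] for every [n], and [step] contracts the l2 norm: the decrease of
    [sum (hit n)^2] from [n] to [n + 1] is
    [sum_(e, f) qE e f * (hit n f - hit n.+1 e)^2]. A nonincreasing nonnegative
    sequence has vanishing increments, hence (lemma [hit_next])

      [hit n.+1 e - hit n f] tends to [0] whenever [f] may follow [e].

    It remains to follow non-backtracking paths ([tied e a f b] says that
    [hit (n + a) e] and [hit (n + b) f] are asymptotically equal) and to combine
    the resulting asymptotic equalities with the conservation of mass.

    Finite graph, Cesaro means. The time averages [avg e] satisfy
    [avg e ~ avg f] whenever [f] may follow [e]. If [e <> f] end at the same
    vertex, then [erev f] may follow [e] and [erev e] may follow [f], so that
    [avg e + avg (erev e) ~ avg f + avg (erev f)]. By connectedness this sum is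
    asymptotically the same for all edges, and conservation of mass gives its
    limit. The sum of [avg] over the edges ending at [x] and the sum over those
    starting at [x] are asymptotically equal, both being Cesaro means of
    [deg x * nbrw k x y] up to a shift of [k] by one, so only the reversal-symmetric sums matter. Periodicity
    and the fact that a cycle splits into its two orientations do no harm.

    Finite graph, degrees at least 3. Any two edges leaving a vertex can follow a
    common edge, so they are tied at equal times, and any walk of length [k],
    backtracking or not, ties the edges leaving its endpoints with time difference
    [k]. Going back and forth along an edge gives period 2; so edges whose initial
    vertices are joined by a walk of even length are tied at equal times. If the graph is not bipartite these are all edges; otherwise
    they form two classes of equal size, one of which carries all the mass at any
    given time.

    Infinite graph. Suppose that [hit n e0] does not tend to [0]. No edge tied to
    [e0] is then null. Such an edge leads to a vertex of degree at least 3, for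
    otherwise its future is a deterministic ray, which never comes back since the
    graph is not a cycle, and visits [y] finitely often. At that vertex the walk
    may asymptotically turn around. So the set of edges tied to [e0] is
    closed under steps and reversal, hence contains all edges, and [hit n e0] is
    asymptotically periodic in [n]. Infinitely many edges then have the same time
    difference to [e0] modulo the period, all with asymptotically the same value
    of [hit]; as the total mass is [deg y], that value tends to [0]. *)

(** * The doubly stochastic operator on functions of oriented edges *)

Section Operator.
Variables (R : realType) (X : multigraph).
Hypothesis X_lf : locally_finite_graph X.
Hypothesis X_deg : forall x : X, (2 <= deg x)%N.
Implicit Types (x y : X) (e f g : oedge X) (h : oedge X -> R).
Implicit Types (B : set (oedge X)) (V : set X).

Lemma finite_out x : finite_set (out_edges x). Proof. exact: X_lf. Qed.
Lemma finite_in x : finite_set (in_edges x). Proof. exact: finite_in_edges. Qed.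
Hint Resolve finite_out finite_in : core.

Lemma bij_rev_in_out x : set_bij (in_edges x) (out_edges x) (@erev X).
Proof.
split=> [e /= <-|e f _ _ /(inv_inj (@erevK X)) //|e /= ex].
  by rewrite /out_edges /= einit_rev.
by exists (erev e); rewrite /in_edges /= ?eterm_rev ?erevK.
Qed.

Lemma sum_rev_in x h :
  \sum_(e \in out_edges x) h e = \sum_(e \in in_edges x) h (erev e).
Proof. exact/reindex_fsbig/bij_rev_in_out. Qed.

Lemma nb_next_rev e f : nb_next (erev f) (erev e) = nb_next e f.
Proof.
rewrite /nb_next einit_rev eterm_rev erevK eq_sym; congr (_ && ~~ _).
by rewrite eq_sym -(inj_eq (inv_inj (@erevK X))) erevK.
Qed.

Lemma qE_ge0 e f : 0 <= qE R e f.
Proof.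
rewrite /qE; case: ifP => // _; rewrite invr_ge0 subr_ge0 ler1n.
exact: leq_trans (X_deg _).
Qed.

Lemma qE_gt0 e f : nb_next e f -> 0 < qE R e f.
Proof. by move=> ef; rewrite /qE ef invr_gt0 subr_gt0 ltr1n X_deg. Qed.

Lemma qE_rev e f : qE R (erev f) (erev e) = qE R e f.
Proof.
rewrite /qE nb_next_rev; case: ifP => // /andP[/eqP ef _].
by rewrite eterm_rev ef.
Qed.

(** Reversal transposes the matrix [qE], so its rows inherit the sums of its
    columns. *)
Lemma qE_row e : \sum_(g \in out_edges (eterm e)) qE R e g = 1.
Proof.
rewrite sum_rev_in -(qE_col R X_lf (X_deg (einit (erev e)))) einit_rev.
by apply: eq_fsbigr => g _; rewrite -[in LHS]qE_rev erevK.
Qed.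

Lemma qE_eq0 e f : einit f <> eterm e -> qE R e f = 0.
Proof. by rewrite /qE /nb_next; case: eqP. Qed.

(** If [V] contains the initial vertices of the edges in the support of [h], then
    [outs V] supports [h] and [ins V] supports [step h]; the block of [qE] with
    rows [ins V] and columns [outs V] is itself doubly stochastic, which reduces
    infinite sums to finite ones. *)
Definition outs V : set (oedge X) := [set e | V (einit e)].
Definition ins V : set (oedge X) := [set e | V (eterm e)].

Lemma finite_outs V : finite_set V -> finite_set (outs V).
Proof.
move=> finV; apply: (@sub_finite_set _ _ (\bigcup_(x in V) out_edges x)).
  by move=> e Ve; exists (einit e).
exact: bigcup_finite.
Qed.

Lemma finite_ins V : finite_set V -> finite_set (ins V).
Proof.
move=> finV; apply: (@sub_finite_set _ _ (\bigcup_(x in V) in_edges x)).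
  by move=> e Ve; exists (eterm e).
exact: bigcup_finite.
Qed.

Lemma qE_row_outs V e : V (eterm e) -> \sum_(g \in outs V) qE R e g = 1.
Proof.
move=> Ve; rewrite -(qE_row e); apply/esym/fsbig_widen => [g /= ge|g [_ /= ge]].
  by rewrite /outs /= ge.
exact: qE_eq0.
Qed.

Lemma qE_col_ins V g : V (einit g) -> \sum_(e \in ins V) qE R e g = 1.
Proof.
move=> Vg; rewrite -(qE_col R X_lf (X_deg (einit g))).
apply/esym/fsbig_widen => [e /= eg|e [_ /= eg]]; first by rewrite /ins /= eg.
by apply: qE_eq0 => ge; exact: eg.
Qed.

Lemma fsum_support h B : (forall e, ~ B e -> h e = 0) ->
  \sum_(e \in [set: oedge X]) h e = \sum_(e \in B) h e.
Proof. by move=> hB; apply/esym/fsbig_widen => // e [_ /= Be]; exact: hB. Qed.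

Definition step h e : R := \sum_(g \in [set: oedge X]) qE R e g * h g.

Lemma step_out h e :
  step h e = \sum_(g \in out_edges (eterm e)) qE R e g * h g.
Proof. by apply: fsum_support => g eg; rewrite qE_eq0 ?mul0r. Qed.

Lemma step_outs h V e : V (eterm e) ->
  step h e = \sum_(g \in outs V) qE R e g * h g.
Proof.
move=> Ve; apply: fsum_support => g eg; rewrite qE_eq0 ?mul0r // => ge.
by apply: eg; rewrite /outs /= ge.
Qed.

Lemma step_ge0 h : (forall e, 0 <= h e) -> forall e, 0 <= step h e.
Proof. by move=> h0 e; apply: fsumr_ge0 => g _; rewrite mulr_ge0 // qE_ge0. Qed.

Lemma step_ins h V : (forall g, ~ outs V g -> h g = 0) ->
  forall e, ~ ins V e -> step h e = 0.
Proof.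
move=> hV e Ve; rewrite step_out; apply: fsbig1 => g /= ge.
by rewrite hV ?mulr0 // /outs /= ge.
Qed.

Definition finitely_supported h :=
  exists2 V : set X, finite_set V & forall g, ~ outs V g -> h g = 0.

Lemma finitely_supported_step h :
  finitely_supported h -> finitely_supported (step h).
Proof.
case=> V finV hV; exists (@einit X @` ins V); first exact/finite_image/finite_ins.
by move=> e eV; apply: (step_ins hV) => Ve; apply: eV; exists e.
Qed.

Lemma step_sum h : finitely_supported h ->
  \sum_(e \in [set: oedge X]) step h e = \sum_(e \in [set: oedge X]) h e.
Proof.
case=> V finV hV; rewrite (fsum_support hV) (fsum_support (step_ins hV)).
rewrite (eq_fsbigr (fun e => \sum_(g \in outs V) qE R e g * h g)); last first.
  by move=> e /set_mem Ve; exact: step_outs.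
rewrite exchange_fsbig; [|exact: finite_ins|exact: finite_outs].
by apply: eq_fsbigr => g /set_mem Vg; rewrite -mulr_fsuml qE_col_ins // mul1r.
Qed.

Lemma sum_in_step h x :
  \sum_(e \in in_edges x) step h e = \sum_(g \in out_edges x) h g.
Proof.
rewrite (eq_fsbigr (fun e => \sum_(g \in out_edges x) qE R e g * h g)); last first.
  by move=> e /set_mem <-; exact: step_out.
rewrite exchange_fsbig //; apply: eq_fsbigr => g /set_mem <-.
by rewrite -mulr_fsuml qE_col // mul1r.
Qed.

(** The defect [sum h^2 - sum (step h)^2] is the sum over all [e], [f] of the
    nonnegative quantities on the left: expand the square and use that rows and
    columns of [qE] sum to [1]. *)
Lemma step_energy h e f : finitely_supported h -> nb_next e f ->
  qE R e f * (h f - step h e) ^+ 2 <=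
  \sum_(a \in [set: oedge X]) h a ^+ 2 - \sum_(a \in [set: oedge X]) step h a ^+ 2.
Proof.
(* The support may miss [f], so its initial vertex is added. *)
case=> V0 finV0 hV0 ef; pose V := V0 `|` [set einit f].
have finV : finite_set V by rewrite finite_setU; split=> //; exact: finite_set1.
have hV g : ~ outs V g -> h g = 0 by move=> Vg; apply: hV0 => V0g; apply: Vg; left.
have [finO finI] := (finite_outs finV, finite_ins finV).
rewrite (@fsum_support _ (outs V)); last by move=> a /hV ->; rewrite expr0n.
rewrite (@fsum_support _ (ins V)); last first.
  by move=> a /(step_ins hV) ->; rewrite expr0n.
have -> : \sum_(a \in outs V) h a ^+ 2 - \sum_(a \in ins V) step h a ^+ 2 =
    \sum_(a \in ins V) \sum_(g \in outs V) qE R a g * (h g - step h a) ^+ 2.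
  have -> : \sum_(a \in outs V) h a ^+ 2 =
      \sum_(a \in ins V) \sum_(g \in outs V) qE R a g * h g ^+ 2.
    rewrite exchange_fsbig //; apply: eq_fsbigr => g /set_mem Vg.
    by rewrite -mulr_fsuml qE_col_ins // mul1r.
  apply/eqP; rewrite subr_eq -fsbig_split //; apply/eqP.
  apply: eq_fsbigr => a /set_mem Va /=.
  have -> : step h a ^+ 2 = \sum_(g \in outs V)
      qE R a g * (2 * h g * step h a - step h a ^+ 2).
    transitivity (step h a * (\sum_(g \in outs V) qE R a g * h g) * 2 - 
      step h a ^+ 2 * \sum_(g \in outs V) qE R a g).
      rewrite -step_outs // qE_row_outs //; ring.
    rewrite !fsbig_finite // !mulr_sumr mulr_suml -sumrB.
    by apply: eq_bigr => g _; ring.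
  by rewrite -fsbig_split //; apply: eq_fsbigr => g _ /=; ring.
have [/eqP fe _] := andP ef.
rewrite (fsbigD1 e) //=; last by right; rewrite /= fe.
rewrite (fsbigD1 f) //=; last by right.
rewrite -addrA lerDl addr_ge0 // fsumr_ge0 // => a _; last apply: fsumr_ge0 => g _.
all: by rewrite mulr_ge0 ?qE_ge0 ?sqr_ge0.
Qed.
End Operator.

(** * Asymptotically equal sequences *)

Section Asym.
Variable R : realType.
Implicit Types (u v w : nat -> R) (l : R).

Definition asym u v := (fun n => u n - v n) @ \oo --> (0 : R).

Lemma asym_refl u : asym u u.
Proof. by rewrite /asym; under eq_fun do rewrite subrr; exact: cvg_cst. Qed.

Lemma eq_cvgn u v l : u =1 v -> u @ \oo --> l -> v @ \oo --> l.
Proof. by move=> /funext ->. Qed.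

Lemma eq_asym u v u' v' : u =1 u' -> v =1 v' -> asym u v -> asym u' v'.
Proof. by move=> /funext -> /funext ->. Qed.

Lemma asym_sym u v : asym u v -> asym v u.
Proof.
move=> uv; rewrite /asym -oppr0; apply: eq_cvgn (cvgN uv) => n.
by rewrite /= opprB.
Qed.

Lemma asym_trans v u w : asym u v -> asym v w -> asym u w.
Proof.
move=> uv vw; rewrite /asym -(addr0 (0 : R)).
by apply: eq_cvgn (cvgD uv vw) => n; rewrite /= addrA subrK.
Qed.

Lemma asymD u v u' v' : asym u v -> asym u' v' ->
  asym (fun n => u n + u' n) (fun n => v n + v' n).
Proof.
move=> uv vw; rewrite /asym -(addr0 (0 : R)).
by apply: eq_cvgn (cvgD uv vw) => n; rewrite /= opprD addrACA.
Qed.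

Lemma asym_sum (I : eqType) (s : seq I) (u v : I -> nat -> R) :
  (forall i, i \in s -> asym (u i) (v i)) ->
  asym (fun n => \sum_(i <- s) u i n) (fun n => \sum_(i <- s) v i n).
Proof.
elim: s => [|i s IH] uv.
  by apply: eq_asym (asym_refl (fun=> 0)) => n; rewrite big_nil.
apply: (@eq_asym (fun n => u i n + \sum_(j <- s) u j n)
  (fun n => v i n + \sum_(j <- s) v j n)) => [n|n|]; rewrite ?big_cons //.
apply: asymD; first exact/uv/mem_head.
by apply: IH => j js; apply: uv; rewrite in_cons js orbT.
Qed.

Lemma asym_shift a u v :
  asym (fun n => u (n + a)%N) (fun n => v (n + a)%N) <-> asym u v.
Proof. by rewrite /asym -(cvg_shiftn a (fun n => u n - v n)). Qed.

Lemma asym_comp (t : nat -> nat) u v : (forall n, n <= t n)%N ->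
  asym u v -> asym (fun n => u (t n)) (fun n => v (t n)).
Proof.
move=> nt; apply: (@cvg_comp _ _ _ t (fun n => u n - v n)) => A [N _ NA].
by exists N => // n /= Nn; apply: NA; exact: leq_trans (nt n).
Qed.

Lemma asym_cvg u v l : asym u v -> v @ \oo --> l -> u @ \oo --> l.
Proof.
move=> uv vl; rewrite -(add0r l).
by apply: eq_cvgn (cvgD uv vl) => n; rewrite /= subrK.
Qed.

Lemma cvg_fsum (I : choiceType) (B : set I) (u : I -> nat -> R) l :
  finite_set B -> (forall i, B i -> u i @ \oo --> l) ->
  (fun n => \sum_(i \in B) u i n) @ \oo --> #|` fset_set B|%:R * l.
Proof.
move=> finB ul.
apply: (@asym_cvg _ (fun=> \sum_(i <- (fset_set B : seq I)) l)); last first.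
  by rewrite big_const_seq count_predT iter_addr_0 mulr_natl; exact: cvg_cst.
apply: (@eq_asym (fun n => \sum_(i <- (fset_set B : seq I)) u i n)
    (fun=> \sum_(i <- (fset_set B : seq I)) l)) => // [n|].
  by rewrite fsbig_finite.
apply: asym_sum => i; rewrite in_fset_set // => /set_mem /ul il.
by rewrite /asym -(subrr l); apply: cvgB => //; exact: cvg_cst.
Qed.

(** All members of the family are asymptotically equal to [w], hence so is their
    average. *)
Lemma asym_average (I : choiceType) (B : set I) w (u : I -> nat -> R) l :
  finite_set B -> B !=set0 -> (forall i, B i -> asym w (u i)) ->
  (fun n => \sum_(i \in B) u i n) @ \oo --> l ->
  w @ \oo --> l / #|` fset_set B|%:R.
Proof.
move=> finB [i0 Bi0] wu ul.
have N0 : #|` fset_set B|%:R != 0 :> R.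
  rewrite pnatr_eq0 cardfs_eq0; apply/eqP => B0.
  by have := Bi0; rewrite -(fset_setK finB) B0.
have wl : (fun n => #|` fset_set B|%:R * w n) @ \oo --> l.
  apply: asym_cvg ul.
  apply: (@eq_asym (fun n => \sum_(i <- (fset_set B : seq I)) w n)
    (fun n => \sum_(i <- (fset_set B : seq I)) u i n)) => [n|n|]; last 1 first.
  - by apply: asym_sum => i; rewrite in_fset_set // => /set_mem; exact: wu.
  - by rewrite big_const_seq count_predT iter_addr_0 mulr_natl.
  - by rewrite fsbig_finite.
apply: (@eq_cvgn (fun n => #|` fset_set B|%:R * w n / #|` fset_set B|%:R)).
  by move=> n; rewrite mulrC mulKf.
exact: cvgMr_tmp.
Qed.

(** If [w] is asymptotically equal to each of [N] members of the family, it is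
    asymptotically at most [d / N]; and [N] may be taken arbitrarily large. *)
Lemma asym_null (I : choiceType) (B : set I) w (u : I -> nat -> R) (d : R) :
  infinite_set B -> (forall i, B i -> asym w (u i)) ->
  (forall n, 0 <= w n) ->
  (forall (F : {fset I}) n, \sum_(i <- F) u i n <= d) ->
  w @ \oo --> (0 : R).
Proof.
move=> infB wu w0 ud; apply/cvgr0Pnorm_lt => e e0.
have d0 : 0 <= d by apply: le_trans (ud fset0 0%N); rewrite big_seq_fset0.
(* With [M] terms of the family the bound becomes [d / M + e / (2 * M) < e]. *)
pose M := (Num.trunc (2 * d / e)).+1.
have dM : 2 * d / e < M%:R by exact: truncnS_gt.
have [F FB MF] := infinite_set_fset M infB.
have F0 : 0 < #|` F|%:R :> R by rewrite ltr0n; exact: leq_trans MF.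
have : asym (fun n => \sum_(i <- F) w n) (fun n => \sum_(i <- F) u i n).
  by apply: asym_sum => i iF; apply/wu/FB.
rewrite /asym => /cvgr0Pnorm_lt /(_ (e / 2)).
have e20 : 0 < e / 2 by rewrite divr_gt0.
move=> /(_ e20); apply: filterS => n; rewrite (ger0_norm (w0 n)).
rewrite big_const_seq count_predT iter_addr_0 -(mulr_natl (w n)) => /ltr_normlW.
rewrite ltrBlDr => wn.
have {}wn : #|` F|%:R * w n < e / 2 + d.
  by apply: (lt_le_trans wn); rewrite lerD2l.
rewrite -(ltr_pM2l F0); apply: (lt_le_trans wn).
have M1 : 1 <= M%:R :> R by rewrite ler1n.
have {}MF : M%:R <= #|` F|%:R :> R by rewrite ler_nat.
move: dM; rewrite ltr_pdivrMr // => dM.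
have : M%:R * e <= #|` F|%:R * e by rewrite ler_pM2r.
have : 1 * e <= #|` F|%:R * e by rewrite ler_pM2r // (le_trans M1).
by lra.
Qed.
End Asym.

(** * Hitting probabilities *)

Section Hit.
Variables (R : realType) (X : multigraph).
Hypothesis X_lf : locally_finite_graph X.
Hypothesis X_deg : forall x : X, (2 <= deg x)%N.
Variable y : X.
Implicit Types (x z : X) (e f g : oedge X) (n k : nat).

(** [hit n e] is the probability that a walk having just traversed [e] is at [y]
    after [n] further steps. *)
Definition hit n : oedge X -> R :=
  iter n (@step R X) (fun e => (eterm e == y)%:R).

Lemma hitS n e : hit n.+1 e = step (hit n) e. Proof. by []. Qed.

Lemma hitE n e : hit n e = \sum_(f \in in_edges y) qEn R n e f.
Proof.
have fin_y := finite_in_edges X_lf y; elim: n e => [|n IH] e.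
  rewrite /hit /=; case: eqP => [ey|ey].
    rewrite (fsbigD1 e) //= eqxx fsbig1 ?addr0 // => f [_ /= fe].
    by case: eqP => // ef; case: fe.
  rewrite fsbig1 // => f /= fy; case: eqP => // ef.
  by case: ey; rewrite ef.
have fin_out := finite_out X_lf (eterm e).
rewrite hitS step_out; symmetry.
transitivity (\sum_(f \in in_edges y) \sum_(g \in out_edges (eterm e))
    qE R e g * qEn R n g f).
  by apply: eq_fsbigr => f _; rewrite /= -step_out.
rewrite exchange_fsbig //; apply: eq_fsbigr => g _.
by rewrite IH mulr_fsumr.
Qed.

Lemma hit_ge0 n e : 0 <= hit n e.
Proof.
elim: n e => [|n IH] e; first by rewrite /hit /= ler0n.
by rewrite hitS; exact: step_ge0.
Qed.

Lemma nbrw_in n x :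
  nbrw R n x y = (deg x)%:R^-1 * \sum_(e \in in_edges x) hit n e.
Proof.
rewrite nbrwE //; congr (_ * _); apply: eq_fsbigr => e _; exact/esym/hitE.
Qed.

Lemma nbrw_out n x :
  nbrw R n.+1 x y = (deg x)%:R^-1 * \sum_(e \in out_edges x) hit n e.
Proof. by rewrite nbrw_in -sum_in_step. Qed.

Lemma finitely_supported_hit n : finitely_supported (hit n).
Proof.
elim: n => [|n IH]; last exact: finitely_supported_step.
exists (@einit X @` in_edges y); first exact/finite_image/finite_in_edges.
move=> e; rewrite /hit /=; case: eqP => // ey []; exact: imageP.
Qed.

Lemma sum_hit n : \sum_(e \in [set: oedge X]) hit n e = (deg y)%:R.
Proof.
elim: n => [|n IH].
  rewrite (@fsum_support _ _ _ (in_edges y)); last first.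
    by move=> e; rewrite /hit /=; case: eqP.
  rewrite (eq_fsbigr (fun=> 1)); last first.
    by move=> e /set_mem ey; rewrite /hit /= (ey : eterm e = y) eqxx.
  rewrite -(sum_rev_in y (fun=> 1)) fsbig_finite; last exact: finite_out.
  by rewrite big_const_seq count_predT iter_addr_0 deg_card.
by rewrite -IH; apply: step_sum => //; exact: finitely_supported_hit.
Qed.

Lemma sum_hit_le (F : {fset oedge X}) n : \sum_(e <- F) hit n e <= (deg y)%:R.
Proof.
have [V finV hV] := finitely_supported_hit n.
rewrite -(sum_hit n) (@fsum_support _ _ _ ([set` F] `|` (outs V `\` [set` F]))).
  rewrite fsbigU0 //; [|exact/finite_setD/finite_outs|by move=> e [Fe []]].
  by rewrite -fsbig_seq ?fset_uniq // lerDl fsumr_ge0 // => e _; exact: hit_ge0.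
move=> e FVe; apply: hV => Ve; apply: FVe.
by have [Fe|Fe] := pselect ([set` F] e); [left|right].
Qed.

Lemma hit_le n e : hit n e <= (deg y)%:R.
Proof. by have := sum_hit_le [fset e]%fset n; rewrite big_seq_fset1. Qed.

Let energy n := \sum_(e \in [set: oedge X]) hit n e ^+ 2.

(** The energies decrease to a limit, so their increments vanish, and
    [step_energy] bounds the squared difference by such an increment. *)
Lemma hit_next e f : nb_next e f -> asym (fun n => hit n.+1 e) (hit ^~ f).
Proof.
move=> ef; have q0 := qE_gt0 R X_deg ef.
have en n : qE R e f * (hit n f - hit n.+1 e) ^+ 2 <= energy n - energy n.+1.
  by apply: step_energy => //; exact: finitely_supported_hit.
have cE : cvgn energy.
  apply: nonincreasing_is_cvgn.
    apply/nonincreasing_seqP => n; rewrite -subr_ge0; apply: le_trans (en n).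
    by rewrite mulr_ge0 ?sqr_ge0 // ltW.
  by exists 0 => _ [n _ <-]; apply: fsumr_ge0 => g _; exact: sqr_ge0.
have {cE} dE : (fun n => energy n - energy n.+1) @ \oo --> (0 : R).
  rewrite -(subrr (limn energy)); apply: cvgB => //.
  by rewrite (cvg_shiftS energy).
apply/asym_sym/cvgr0Pnorm_lt => eps eps0.
have eps1 : 0 < qE R e f * eps ^+ 2 by rewrite mulr_gt0 // exprn_gt0.
move/cvgr0Pnorm_lt: dE => /(_ _ eps1); apply: filterS => n.
move=> /ltr_normlW /(le_lt_trans (en n)); rewrite ltr_pM2l //.
by rewrite -[X in X < _]real_normK ?num_real // ltr_pXn2r ?nnegrE ?normr_ge0 // ltW.
Qed.

End Hit.

(** * Cesaro means *)

Section Mean.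
Variable R : realType.
Implicit Types (u v : nat -> R).

Lemma mean_fsum (I : choiceType) (B : set I) (u : I -> nat -> R) n :
  finite_set B ->
  arithmetic_mean (fun k => \sum_(i \in B) u i k) n =
  \sum_(i \in B) arithmetic_mean (u i) n.
Proof.
move=> finB; rewrite /arithmetic_mean /series /= fsbig_finite // -mulr_sumr.
rewrite exchange_big /=; congr (_ * _); apply: eq_bigr => k _.
by rewrite fsbig_finite.
Qed.

Lemma meanZ a u n :
  arithmetic_mean (fun k => a * u k) n = a * arithmetic_mean u n.
Proof. by rewrite /arithmetic_mean /series /= -mulr_sumr mulrCA. Qed.

Lemma asym_mean u v : asym u v -> asym (arithmetic_mean u) (arithmetic_mean v).
Proof.
move=> /cesaro; apply: eq_cvgn => n.
by rewrite /arithmetic_mean /series /= -mulrBr sumrB.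
Qed.

(** The difference telescopes to [(u n.+1 - u 0) / n.+1]. *)
Lemma asym_mean_shift u d : (forall n, 0 <= u n <= d) ->
  asym (arithmetic_mean (fun n => u n.+1)) (arithmetic_mean u).
Proof.
move=> ud; rewrite /asym.
have d0 : 0 <= d by case/andP: (ud 0%N) => /le_trans; apply.
apply: (@squeeze_cvgr _ _ _ _ (fun n => - (d * harmonic n)) (fun n => d * harmonic n)).
- near=> n; rewrite -ler_norml /arithmetic_mean /series /= -mulrBr -sumrB.
  rewrite telescope_sumr // normrM ger0_norm ?invr_ge0 // mulrC ler_pM2r ?invr_gt0 //.
  have /andP[] := ud n.+1; have /andP[] := ud 0%N.
  by rewrite ler_norml => *; apply/andP; split; lra.
- by rewrite -oppr0 -(mulr0 d); apply: cvgN; apply: cvgMl_tmp; exact: cvg_harmonic.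
- by rewrite -[X in _ --> X](mulr0 d); apply: cvgMl_tmp; exact: cvg_harmonic.
Unshelve. all: by end_near. Qed.

End Mean.
(** * Walks *)

Section Walks.
Variable X : multigraph.
Implicit Types (x y z : X) (e f g : oedge X) (s t : seq (oedge X)).

Lemma is_walk_cat x y z s t : is_walk x s y -> is_walk y t z -> is_walk x (s ++ t) z.
Proof.
elim: s x => [|e s IH] x /=; first by move=> ->.
by case=> ex sy yz; split=> //; exact: IH.
Qed.

Lemma is_walk_rev x y s : is_walk x s y ->
  exists2 t, is_walk y t x & size t = size s.
Proof.
elim: s x => [|e s IH] x /=; first by move=> ->; exists [::].
case=> ex /IH [t ty ts]; exists (t ++ [:: erev e]).
  by apply: is_walk_cat ty _; rewrite /= einit_rev eterm_rev.
by rewrite size_cat addn1 ts.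
Qed.

Lemma walk_color (c : X -> bool) x y s : (forall e, c (einit e) != c (eterm e)) ->
  is_walk x s y -> c y = c x (+) odd (size s).
Proof.
move=> cP; elim: s x => [|e s IH] x /=; first by move=> ->; rewrite addbF.
case=> <- /IH ->; have := cP e.
by case: (c _); case: (c _); case: (odd _).
Qed.

Lemma gdist_walk x y : connected_graph X ->
  exists2 s, is_walk x s y & size s = gdist x y.
Proof.
move=> conn; rewrite /gdist; case: pselect => [h|[]].
  by case: ex_minnP => n /asboolP[s [sn sw]] _; exists s.
by have [s sw] := conn x y; exists (size s); apply/asboolP; exists s.
Qed.

(** If no vertex were reached from a fixed vertex by walks of both parities, the
    parity would be a proper 2-colouring. *)
Lemma nonbipartite_even_walk x y : connected_graph X -> ~ bipartite_graph X ->
  exists2 s, is_walk x s y & ~~ odd (size s).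
Proof.
move=> conn nbip.
have [z [s [t [sw tw st]]]] : exists z s t,
    [/\ is_walk x s z, is_walk x t z & odd (size s) != odd (size t)].
  apply: contrapT => nst; apply: nbip.
  pose c z := `[< exists2 s, is_walk x s z & odd (size s) >].
  have cE z s : is_walk x s z -> c z = odd (size s).
    move=> sw; apply/asboolP/idP => [[t tw ot]|os]; last by exists s.
    apply: contra_notT nst => os; exists z, s, t; split=> //.
    by rewrite ot (negbTE os).
  exists c => e; have [s sw] := conn x (einit e).
  rewrite (cE _ s) // (cE _ (s ++ [:: e])); last exact: is_walk_cat sw _.
  by rewrite size_cat addn1 /=; case: odd.
have [r rw] := conn z y; have [s' ws' ss'] := is_walk_rev sw.
have [ev|od] := boolP (odd (size (s ++ r))); last first.
  by exists (s ++ r) => //; exact: is_walk_cat rw.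
exists (t ++ r); first exact: is_walk_cat rw.
by move: ev st; rewrite !size_cat !oddD; do 3 case: odd.
Qed.

Lemma finite_oedges : locally_finite_graph X -> finite_set [set: X] ->
  finite_set [set: oedge X].
Proof. by move=> lf finX; have := finite_outs lf finX. Qed.

Lemma exists_out x s : locally_finite_graph X -> (size s < deg x)%N ->
  exists2 e, einit e = x & e \notin s.
Proof.
move=> lf sx; apply: contrapT => nex; move: sx; apply/negP; rewrite -leqNgt.
rewrite deg_card //; apply: uniq_leq_size; first exact: fset_uniq.
move=> e; rewrite in_fset_set // => /set_mem ex.
by apply: contra_notT nex => es; exists e.
Qed.
End Walks.

(** * Asymptotic equalities between hitting probabilities *)

Section Tied.
Variables (R : realType) (X : multigraph).
Hypothesis X_lf : locally_finite_graph X.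
Hypothesis X_deg : forall x : X, (2 <= deg x)%N.
Variable y : X.
Implicit Types (x z : X) (e f g : oedge X) (n k : nat) (s t : seq (oedge X)).
Notation hit := (@hit R X y).

(** Only the difference of the offsets [a] and [b] matters ([tied_shift]); keeping
    both avoids negative times. *)
Definition tied e a f b := asym (fun n => hit (n + a) e) (fun n => hit (n + b) f).

Lemma tied_refl e a : tied e a e a. Proof. exact: asym_refl. Qed.

Lemma tied_sym e a f b : tied e a f b -> tied f b e a. Proof. exact: asym_sym. Qed.

Lemma tied_shift c e a f b : tied e (a + c) f (b + c) <-> tied e a f b.
Proof.
rewrite /tied -(asym_shift c (fun n => hit (n + a) e)).
suff E d g : (fun n => hit (n + (d + c)) g) = (fun n => hit (n + c + d) g).
  by rewrite !E.
by apply/funext => n; rewrite addnAC addnA.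
Qed.

Lemma tied_trans f b e a g c : tied e a f b -> tied f b g c -> tied e a g c.
Proof. exact: asym_trans. Qed.

Lemma tied_cat e a f g b : tied e a f 0 -> tied f b g 0 -> tied e (a + b) g 0.
Proof. by move=> /(tied_shift b) ef; exact: tied_trans. Qed.

Lemma tied_next e f : nb_next e f -> tied e 1 f 0.
Proof.
move=> ef; apply: eq_asym (@hit_next R X X_lf X_deg y _ _ ef) => n.
  by rewrite addn1.
by rewrite addn0.
Qed.

Lemma tied_path e s : path (@nb_next X) e s -> tied e (size s) (last e s) 0.
Proof.
elim: s e => [|f s IH] e /=; first by move=> _; exact: tied_refl.
by case/andP => /tied_next ef /IH fs; rewrite -add1n; exact: tied_cat fs.
Qed.

Lemma tied_rev_path e s : path (@nb_next X) e s ->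
  tied (erev (last e s)) (size s) (erev e) 0.
Proof.
elim: s e => [|f s IH] e /=; first by move=> _; exact: tied_refl.
case/andP => ef /IH fs; rewrite -addn1; apply: tied_cat fs _.
by apply: tied_next; rewrite nb_next_rev.
Qed.

(** A third edge leaving the vertex, once reversed, may be followed by [e] as well
    as by [f]. *)
Lemma tied_fork e f : (3 <= deg (einit e))%N -> einit f = einit e -> tied e 0 f 0.
Proof.
move=> d3 fe; have [h he /negP hef] := @exists_out _ (einit e) [:: e; f] X_lf d3.
have next g : einit g = einit e -> g \in [:: e; f] -> nb_next (erev h) g.
  move=> ge gef; rewrite /nb_next eterm_rev he ge eqxx /=.
  by rewrite erevK; apply/eqP => gh; apply: hef; rewrite -gh.
apply: (@tied_trans (erev h) 1).
  by apply/tied_sym/tied_next/next => //; rewrite inE eqxx.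
by apply/tied_next/next => //; rewrite !inE eqxx orbT.
Qed.

Lemma exists_next e : exists f, nb_next e f.
Proof.
have [|f fe fs] := @exists_out _ (eterm e) [:: erev e] X_lf; first exact: X_deg.
by exists f; rewrite /nb_next fe eqxx; move: fs; rewrite inE.
Qed.

(** The edge [f] is allowed to be [erev e]: at a vertex of degree at least 3 the
    ban on backtracking has no asymptotic effect. *)
Lemma tied_through e f : (3 <= deg (einit f))%N -> eterm e = einit f -> tied e 1 f 0.
Proof.
move=> d3 ef; have [g eg] := exists_next e.
apply: tied_trans (tied_next eg) _; apply/tied_sym/tied_fork => //.
by rewrite -ef; case/andP: eg => /eqP.
Qed.

(** Since backtracking has no asymptotic effect, [s] is an arbitrary walk. *)
Lemma tied_walk e f x s : (forall x, (3 <= deg x)%N) ->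
  einit e = x -> is_walk x s (einit f) -> tied e (size s) f 0.
Proof.
move=> d3; elim: s x e => [|g s IH] x e /= ex.
  by rewrite -ex => ef; exact: tied_fork.
case=> gx sw; have [h gh _] := @exists_out _ (eterm g) [::] X_lf (ltnW (X_deg _)).
rewrite -add1n; apply: (@tied_cat _ _ h); last exact: IH sw.
apply: (@tied_trans g 1); last exact: tied_through.
by apply/(tied_shift 1 _ 0 _ 0)/tied_fork => //; rewrite gx.
Qed.

(** The closed walk [e, erev e] makes [hit n e] asymptotically 2-periodic. *)
Lemma tied_even_walk e f s : (forall x, (3 <= deg x)%N) ->
  is_walk (einit e) s (einit f) -> ~~ odd (size s) -> tied e 0 f 0.
Proof.
move=> d3 sw ev; have {sw} ef := tied_walk d3 erefl sw.
have per m : tied e m.*2 e 0.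
  elim: m => [|m IH]; first exact: tied_refl.
  rewrite doubleS -addn2; apply: tied_cat IH _.
  apply: (tied_walk (s := [:: e; erev e]) d3 erefl).
  by rewrite /= einit_rev eterm_rev.
rewrite -(even_halfK ev) in ef.
exact: tied_trans (tied_sym (per _)) ef.
Qed.
End Tied.

(** * Finite graphs *)

Section Limits.
Variables (R : realType) (X : multigraph).
Hypothesis X_lf : locally_finite_graph X.
Hypothesis X_conn : connected_graph X.
Hypothesis X_deg : forall x : X, (2 <= deg x)%N.
Implicit Types (x y z : X) (e f g : oedge X) (n k : nat) (s : seq (oedge X)).
Local Notation hit := (@hit R X).

Lemma deg_neq0 x : (deg x)%:R != 0 :> R.
Proof. by rewrite pnatr_eq0 -lt0n; exact: ltnW (X_deg x). Qed.

Lemma card_in x : #|` fset_set (in_edges x)| = deg x.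
Proof.
apply/eqP; rewrite -(@eqr_nat R); apply/eqP; rewrite deg_card //.
have := sum_rev_in x (fun=> 1 : R).
rewrite !fsbig_finite; [|exact: finite_in|exact: finite_out].
by rewrite !big_const_seq !count_predT !iter_addr_0 => ->.
Qed.

Lemma nbrw_cvg (t : nat -> nat) x y (l : R) :
  (forall e, eterm e = x -> (fun n => hit y (t n) e) @ \oo --> l) ->
  (fun n => nbrw R (t n) x y) @ \oo --> l.
Proof.
move=> hl; have finx := finite_in X_lf x.
apply: (@eq_cvgn _ (fun n => (deg x)%:R^-1 * \sum_(e \in in_edges x) hit y (t n) e)).
  by move=> n; rewrite nbrw_in.
rewrite -[l](mulKf (deg_neq0 x)) -card_in; apply: cvgMl_tmp.
exact: (cvg_fsum (u := fun e n => hit y (t n) e)).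
Qed.

Section Finite.
Hypothesis X_fin : finite_set [set: X].

Let finE : finite_set [set: oedge X] := finite_oedges X_lf X_fin.

Section Mean.
Variable y : X.

Let avg e n := arithmetic_mean (fun k => hit y k e) n.

Lemma avg_next e f : nb_next e f -> asym (avg e) (avg f).
Proof.
move=> ef; apply: asym_trans _ (asym_mean (@hit_next R _ X_lf X_deg y _ _ ef)).
apply/asym_sym/(asym_mean_shift (d := (deg y)%:R)) => n.
by rewrite hit_ge0 // hit_le.
Qed.

(** Two distinct edges entering a vertex may be followed by each other's
    reversals, whatever the degree of the vertex. Adding the two resulting
    asymptotic equalities settles the case of a common terminal vertex, and the
    sum is unchanged when [e] is replaced by [erev e]. *)
Lemma avg_rev_walk e f s : is_walk (eterm e) s (eterm f) ->
  asym (fun n => avg e n + avg (erev e) n) (fun n => avg f n + avg (erev f) n).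
Proof.
have same e1 e2 : eterm e1 = eterm e2 ->
    asym (fun n => avg e1 n + avg (erev e1) n) (fun n => avg e2 n + avg (erev e2) n).
  move=> e12; have [->|ne] := eqVneq e1 e2; first exact: asym_refl.
  apply: (@eq_asym _ (fun n => avg e1 n + avg (erev e1) n)
    (fun n => avg (erev e2) n + avg e2 n)) => // [n|]; first exact: addrC.
  apply: asymD.
    apply: avg_next; rewrite /nb_next einit_rev e12 eqxx /=.
    by rewrite (inj_eq (inv_inj (@erevK X))) eq_sym.
  apply/asym_sym/avg_next; rewrite /nb_next einit_rev e12 eqxx /=.
  by rewrite (inj_eq (inv_inj (@erevK X))).
elim: s e => [|g s IH] e /=; first exact: same.
case=> ge /IH; apply: asym_trans.
apply: (@asym_trans _ (fun n => avg (erev g) n + avg g n)).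
  by have := same e (erev g); rewrite eterm_rev erevK ge; apply.
by apply: eq_asym (asym_refl _) => n; first exact: addrC.
Qed.

Lemma num_oedges_neq0 : (num_oedges X)%:R != 0 :> R.
Proof.
have [e _ _] := exists_out (x := y) (s := [::]) X_lf (ltnW (X_deg y)).
rewrite pnatr_eq0 cardfs_eq0; apply/eqP => E0.
by have := in_fset_set finE e; rewrite E0 in_setT.
Qed.

Lemma avg_rev_cvg e : (fun n => avg e n + avg (erev e) n) @ \oo -->
  (2 * (deg y)%:R / (num_oedges X)%:R : R).
Proof.
apply: (@asym_average _ _ [set: oedge X] _ (fun f n => avg f n + avg (erev f) n)) => //.
- by exists e.
- by move=> f _; have [s] := X_conn (eterm e) (eterm f); exact: avg_rev_walk.
apply: (@eq_cvgn _ (fun=> 2 * (deg y)%:R)); last exact: cvg_cst.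
move=> n; rewrite fsbig_split //=.
rewrite -(@reindex_fsbigT _ _ _ _ _ (@erev X) (avg ^~ n)); last first.
  exact: inv_bij (@erevK X).
rewrite -mean_fsum //.
have -> : (fun k => \sum_(f \in [set: oedge X]) hit y k f) = fun=> (deg y)%:R.
  by apply/funext => k; exact: sum_hit.
rewrite /arithmetic_mean /series /= big_const_nat subn0 iter_addr_0.
by rewrite -(mulr_natl (deg y)%:R n.+1) mulKf // mulr_natl mulr2n.
Qed.

(** The walk at [x] is described both by the edge about to be traversed and by
    the edge just traversed; averaging the two descriptions yields the
    reversal-symmetric quantity whose limit is known. *)
Lemma mean_nbrw_cvg x :
  (fun n : nat => n%:R^-1 * \sum_(1 <= k < n.+1) nbrw R k x y) @ \oo
    --> ((deg y)%:R / (num_oedges X)%:R : R).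
Proof.
have finI := finite_in X_lf x.
pose A n := arithmetic_mean (fun k => nbrw R k.+1 x y) n.
rewrite -cvg_shiftS; apply: (@eq_cvgn _ A) => [n|].
  by rewrite /A /arithmetic_mean /series /= big_add1.
have degA n : (deg x)%:R * A n = \sum_(e \in in_edges x) avg (erev e) n.
  rewrite -(sum_rev_in x (avg ^~ n)) -mean_fsum; last exact: finite_out.
  rewrite -meanZ; congr (arithmetic_mean _ n); apply/funext => k.
  by rewrite nbrw_out // mulVKf // deg_neq0.
have degA' : asym (fun n => \sum_(e \in in_edges x) avg e n) (fun n => (deg x)%:R * A n).
  apply/asym_sym; apply: (@eq_asym _
    (fun n => \sum_(e <- fset_set (in_edges x)) arithmetic_mean (fun k => hit y k.+1 e) n)
    (fun n => \sum_(e <- fset_set (in_edges x)) avg e n)) => [n|n|].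
  - rewrite -fsbig_finite //.
    rewrite -(mean_fsum (fun e k => hit y k.+1 e)) // /A -meanZ.
    congr (arithmetic_mean _ n); apply/funext => k.
    by rewrite nbrw_in // mulVKf // deg_neq0.
  - by rewrite fsbig_finite.
  - apply: asym_sum => e _; apply: (asym_mean_shift (d := (deg y)%:R)) => n.
    by rewrite hit_ge0 // hit_le.
have lim : (fun n => \sum_(e \in in_edges x) (avg e n + avg (erev e) n)) @ \oo -->
    ((deg x)%:R * (2 * (deg y)%:R / (num_oedges X)%:R) : R).
  rewrite -card_in; apply: (cvg_fsum (u := fun e n => avg e n + avg (erev e) n)).
    exact: finI.
  by move=> e _; exact: avg_rev_cvg.
have {}lim : (fun n => 2 * (deg x)%:R * A n) @ \oo -->
    ((deg x)%:R * (2 * (deg y)%:R / (num_oedges X)%:R) : R).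
  apply: asym_cvg lim.
  apply: (@eq_asym _ (fun n => (deg x)%:R * A n + (deg x)%:R * A n)
    (fun n => \sum_(e \in in_edges x) avg e n + (deg x)%:R * A n)) => [n|n|].
  - by ring.
  - by rewrite degA fsbig_split.
  - by apply: asymD; [exact: asym_sym|exact: asym_refl].
have -> : (deg y)%:R / (num_oedges X)%:R =
    (2 * (deg x)%:R)^-1 * ((deg x)%:R * (2 * (deg y)%:R / (num_oedges X)%:R)) :> R.
  by field; rewrite num_oedges_neq0 deg_neq0.
apply: (@eq_cvgn _ (fun n => (2 * (deg x)%:R)^-1 * (2 * (deg x)%:R * A n))).
  by move=> n; rewrite mulKf // mulf_neq0 ?deg_neq0 // pnatr_eq0.
exact: cvgMl_tmp.
Qed.

End Mean.

Section DegreeThree.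
Hypothesis X_deg3 : forall x : X, (3 <= deg x)%N.
Variable y : X.

Lemma nbrw_nonbipartite x : ~ bipartite_graph X ->
  (fun n => nbrw R n x y) @ \oo --> ((deg y)%:R / (num_oedges X)%:R : R).
Proof.
move=> nbip; apply: nbrw_cvg => e _.
apply: (@asym_average _ _ [set: oedge X] _ (fun f n => hit y n f)) => //.
- by exists e.
- move=> f _; have [s sw ev] := nonbipartite_even_walk (einit e) (einit f) X_conn nbip.
  have := @tied_even_walk R _ X_lf X_deg y _ _ _ X_deg3 sw ev.
  by apply: eq_asym => n; rewrite addn0.
- by under eq_fun do rewrite sum_hit //; exact: cvg_cst.
Qed.

(** The colour of the current vertex alternates, so at time [n] only one colour
    is compatible with being at [y]. *)
Lemma hit_color (c : X -> bool) n e : (forall e, c (einit e) != c (eterm e)) ->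
  c (eterm e) != c y (+) odd n -> hit y n e = 0.
Proof.
move=> cP; elim: n e => [|n IH] e.
  by rewrite addbF /hit /=; case: (eterm e =P y) => [->|//]; rewrite eqxx.
move=> ce; rewrite hitS step_out; apply: fsbig1 => g /= ge.
rewrite IH ?mulr0 //; have := cP g; move: ce; rewrite ge /=.
by do 3 case: (c _); case: odd.
Qed.

(** Reversal exchanges the edges starting at the two colours. *)
Lemma card_color (c : X -> bool) b : (forall e, c (einit e) != c (eterm e)) ->
  (num_oedges X)%:R = 2 * #|` fset_set [set e : oedge X | c (einit e) = b]|%:R :> R.
Proof.
move=> cP; set F := [set e : oedge X | c (einit e) = b].
have card (B : set (oedge X)) : finite_set B ->
    #|` fset_set B|%:R = \sum_(e \in B) (1 : R).
  by move=> finB; rewrite fsbig_finite // big_const_seq count_predT iter_addr_0.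
have finB (B : set (oedge X)) : finite_set B by exact: sub_finite_set finE.
rewrite /num_oedges !card // (fsbigID F) // setTI setTI mulr_natl mulr2n.
congr (_ + _); apply: (reindex_fsbig (@erev X)); split.
- move=> e /=; rewrite /F /= einit_rev => eb; have := cP e.
  by rewrite eb; case: (c _); case: (b).
- by move=> e f _ _ /(inv_inj (@erevK X)).
- move=> e; rewrite /F /= => eb; exists (erev e); last exact: erevK.
  by rewrite /= einit_rev; have := cP e; move: eb; case: (c _); case: (c _); case: (b).
Qed.

Lemma nbrw_bipartite x : bipartite_graph X ->
  (fun n : nat => nbrw R (2 * n + odd (gdist x y))%N x y) @ \oo
    --> (2 * (deg y)%:R / (num_oedges X)%:R : R).
Proof.
case=> c cP; set d := odd _.
have cx : c x = c y (+) d.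
  have [s sw ss] := gdist_walk x y X_conn.
  by rewrite (walk_color cP sw) ss -/d addbK.
apply: (nbrw_cvg (t := fun n => (2 * n + d)%N)) => e ex.
have ce : c (einit e) = ~~ c x by have := cP e; rewrite ex; case: (c _); case: (c _).
pose F := [set f : oedge X | c (einit f) = ~~ c x].
have finF : finite_set F by exact: sub_finite_set finE.
rewrite (card_color (~~ c x) cP) -mulf_div divff // mul1r.
apply: (@asym_average _ _ F _ (fun f n => hit y (2 * n + d) f)) => //.
- by exists e.
- move=> f cf; have [s sw] := X_conn (einit e) (einit f).
  have ev : ~~ odd (size s).
    by have := walk_color cP sw; rewrite ce cf; case: (c x); case: odd.
  have := @tied_even_walk R _ X_lf X_deg y _ _ _ X_deg3 sw ev.
  move=> /(asym_comp (t := fun n => 2 * n + d)%N) tied_ef.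
  apply: eq_asym (tied_ef _) => n; rewrite ?addn0 //.
  by rewrite mul2n -addnn -addnA leq_addr.
apply: (@eq_cvgn _ (fun=> (deg y)%:R)); last exact: cvg_cst.
move=> n; rewrite -(sum_hit R X_lf X_deg y (2 * n + d)); apply: fsum_support => f cf.
apply: (hit_color cP); apply: contra_notN cf; rewrite /F /=.
have := cP f; rewrite cx oddD mul2n odd_double /=.
have -> : odd d = d by case: (d).
by case: (c (einit f)); case: (c (eterm f)); case: (c y); case: (d).
Qed.

End DegreeThree.
End Finite.
End Limits.

(** * Infinite graphs *)

Section Infinite.
Variables (R : realType) (X : multigraph).
Hypothesis X_lf : locally_finite_graph X.
Hypothesis X_conn : connected_graph X.
Hypothesis X_deg : forall x : X, (2 <= deg x)%N.
Hypothesis X_inf : infinite_set [set: X].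
Variable y : X.
Implicit Types (x z : X) (e f g : oedge X) (n k : nat) (s : seq (oedge X)).
Notation hit := (@hit R X y).
Notation tied := (@tied R X y).

Definition null e := hit ^~ e @ \oo --> (0 : R).

Lemma null_tied e a f b : tied e a f b -> null f -> null e.
Proof.
rewrite /tied /null -(cvg_shiftn b (hit ^~ f)) => /asym_cvg ef /ef.
by rewrite (cvg_shiftn a (hit ^~ e)).
Qed.

Lemma infinite_oedges : infinite_set [set: oedge X].
Proof.
move=> finE; apply: X_inf; apply: sub_finite_set (finite_image (@einit X) finE).
move=> x _; have [e ex _] := exists_out (x := x) (s := [::]) X_lf (ltnW (X_deg x)).
by exists e.
Qed.

Section Ray.
Variables (next : oedge X -> oedge X) (e0 : oedge X).
Hypothesis nextP : forall e, nb_next e (next e).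
Let ray k := iter k next e0.
Hypothesis ray_deg : forall k, deg (eterm (ray k)) = 2.

Lemma einit_ray k : einit (ray k.+1) = eterm (ray k).
Proof. by have /andP[/eqP] := nextP (ray k). Qed.

Lemma out_ray k f : einit f = eterm (ray k) -> f = ray k.+1 \/ f = erev (ray k).
Proof.
have finO := finite_out X_lf (eterm (ray k)).
move=> fk; pose s := [:: ray k.+1; erev (ray k)].
have us : uniq s by have /andP[_] := nextP (ray k); rewrite /= andbT inE.
have /(uniq_min_size us) : {subset s <= fset_set (out_edges (eterm (ray k)))}.
  move=> g; rewrite !inE in_fset_set // => /orP[/eqP->|/eqP->]; apply/mem_set.
    exact: einit_ray.
  exact: einit_rev.
rewrite -deg_card // ray_deg => /(_ isT) [_ sE].
have : f \in s by rewrite sE in_fset_set //; exact/mem_set.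
by rewrite !inE => /orP[/eqP|/eqP]; [left|right].
Qed.

Lemma step_ray (h : oedge X -> R) k : step h (ray k) = h (ray k.+1).
Proof.
have finO := finite_out X_lf (eterm (ray k)).
rewrite step_out (fsbigD1 (ray k.+1)) //=; last exact: einit_ray.
rewrite fsbig1 => [|g [/= /out_ray[->//|->] _]]; last first.
  by rewrite /qE /nb_next eqxx andbF mul0r.
by rewrite addr0 /qE nextP ray_deg -(natrB R (isT : (1 <= 2)%N)) invr1 mul1r.
Qed.

Lemma hit_ray n k : hit n (ray k) = (eterm (ray (n + k)) == y)%:R.
Proof. by elim: n k => [//|n IH] k; rewrite hitS step_ray IH addSnnS. Qed.

(** A ray through vertices of degree 2 that returned to one of its edges would
    trace a cycle with no exit, and by connectedness the graph would be that
    cycle. *)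
Lemma ray_inj : injective ray.
Proof.
suff main i j : (i < j)%N -> ray i <> ray j.
  move=> i j ij; case: (ltngtP i j) => // ltij; first by case: (main _ _ ltij).
  by case: (main _ _ ltij).
move=> ij ray_ij; apply: X_inf.
(* From the first repetition on, the ray runs through the edges again. *)
have ray_lt k : exists2 m, (m < j)%N & ray k = ray m.
  elim: k => [|k [m mj km]]; first by exists 0%N => //; exact: leq_trans ij.
  have [mj'|mj'] := ltnP m.+1 j.
    by exists m.+1; rewrite // /ray !iterS -/(ray k) km.
  exists i => //; rewrite ray_ij (_ : j = m.+1); last first.
    by apply/eqP; rewrite eqn_leq mj' mj.
  by rewrite /ray !iterS -/(ray k) km.
(* The vertex preceding [ray k] is also on the ray, at [j.-1] if [k = i]. *)
have back k : (i <= k)%N -> exists2 m, (i <= m)%N & einit (ray k) = eterm (ray m).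
  rewrite leq_eqVlt => /predU1P[<-|]; last first.
    by case: k => // k ik; exists k => //; exact: einit_ray.
  rewrite ray_ij -(ltn_predK ij) einit_ray; exists j.-1 => //.
  by rewrite -ltnS (ltn_predK ij).
apply: (@sub_finite_set _ _ ((fun k => eterm (ray k)) @` `I_j)); last exact: finite_image.
move=> z _; have [s] := X_conn (eterm (ray i)) z.
(* Every walk that starts on the cycle stays on it. *)
have : (i <= i)%N by [].
elim: s {2 3}i => [|f s IH] k ik /=.
  by move=> <-; have [m mj km] := ray_lt k; exists m => //; rewrite km.
case=> /out_ray [->|->]; first by apply: IH; exact: leqW.
by rewrite eterm_rev; have [m im ->] := back k ik; exact: IH.
Qed.

(** Along the ray the walk is deterministic, and being injective the ray meets the
    finitely many edges ending at [y] only finitely often. *)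
Lemma null_ray : null e0.
Proof.
have finB : finite_set (ray @^-1` in_edges y).
  apply: (@finite_preimage _ _ _ _ _); last exact: finite_in.
  by move=> i j _ _; exact: ray_inj.
pose N := (\max_(i <- fset_set (ray @^-1` in_edges y)) i).+1.
rewrite /null -(cvg_shiftn N (hit ^~ e0)).
apply: (@eq_cvgn _ (fun=> 0)); last exact: cvg_cst.
move=> n; suff hit0 : hit (n + N) (ray 0) = 0 by exact/esym/hit0.
rewrite hit_ray addn0; case: eqP => // ny.
have : (n + N <= \max_(i <- fset_set (ray @^-1` in_edges y)) i)%N.
  by apply: leq_bigmax_seq => //; rewrite in_fset_set //; exact/mem_set.
by rewrite /N addnS ltnNge leq_addl.
Qed.
End Ray.

Lemma reach_branching e : ~ null e ->
  exists2 s, path (@nb_next X) e s & (3 <= deg (eterm (last e s)))%N.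
Proof.
move=> nn; apply: contrapT => nb; apply: nn.
have [next nextP] := choice (exists_next X_lf X_deg).
apply: (null_ray nextP) => k; apply/eqP; rewrite eqn_leq X_deg andbT leqNgt.
apply: contra_notN nb => d3.
have [s es sk] : exists2 s, path (@nb_next X) e s & last e s = iter k next e.
  elim: k {d3} => [|k [s es sk]]; first by exists [::].
  exists (rcons s (next (iter k next e))); last by rewrite last_rcons.
  by rewrite rcons_path es sk nextP.
by exists s => //; rewrite sk.
Qed.

Section NotNull.
Variable e0 : oedge X.
Hypothesis e0_nnull : ~ null e0.

Let linked e := exists a b, tied e a e0 b.

Lemma linked_tied e a f b : tied f b e a -> linked e -> linked f.
Proof.
move=> fe [c [d ee0]]; exists (b + c)%N, (d + a)%N.
apply: (@tied_trans _ _ _ e (a + c)); first exact/tied_shift.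
by rewrite (addnC a); exact/tied_shift.
Qed.

(** A non-null edge leads to a vertex of degree at least 3, where the walk may
    asymptotically turn around and come back. *)
Lemma linked_uturn e : linked e -> exists2 k, (0 < k)%N & tied e k (erev e) 0.
Proof.
move=> [a [b ee0]]; have [|s es d3] := @reach_branching e.
  by move=> /(null_tied (tied_sym ee0)).
exists (size s + (1 + size s))%N; first by rewrite addnCA.
have p1 := @tied_path R X X_lf X_deg y _ _ es.
have p2 := @tied_rev_path R X X_lf X_deg y _ _ es.
apply: tied_cat p1 _; apply: tied_cat _ p2.
by apply: tied_through => //; rewrite einit_rev.
Qed.

Lemma linked_rev e : linked e -> linked (erev e).
Proof.
by move=> le; have [k _ /tied_sym ke] := linked_uturn le; exact: linked_tied ke le.
Qed.

Lemma linked_out e f : linked e -> einit f = eterm e -> linked f.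
Proof.
move=> le fe; have [->|ne] := eqVneq f (erev e); first exact: linked_rev.
have ef : nb_next e f by rewrite /nb_next fe eqxx.
have fe1 := tied_sym (@tied_next R X X_lf X_deg y _ _ ef).
exact: linked_tied fe1 le.
Qed.

Lemma linked_all f : linked f.
Proof.
have [s] := X_conn (eterm e0) (einit f).
have : linked e0 by exists 0%N, 0%N; exact: tied_refl.
elim: s e0 => [|g s IH] e le /=; first by move=> ef; exact: (linked_out le).
by case=> ge; apply: IH; exact: (linked_out le).
Qed.

(** Turning around twice leads back to [e0]. *)
Lemma tied_period : exists2 p, (0 < p)%N & forall m, tied e0 (m * p) e0 0.
Proof.
have [k k0 ek] := linked_uturn (linked_all e0).
have [l _ el] := linked_uturn (linked_all (erev e0)).
exists (k + l)%N => [|m]; first by rewrite addn_gt0 k0.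
elim: m => [|m IH]; first exact: tied_refl.
rewrite mulSn; apply: tied_cat IH; apply: tied_cat ek _.
by rewrite erevK in el.
Qed.

(** Modulo the period there are finitely many time differences to [e0], so one of
    them is shared by infinitely many edges, and [asym_null] applies. *)
Lemma nonnull_absurd : False.
Proof.
have [p p0 per] := tied_period.
have red f : exists2 r, (r < p)%N & tied f 0 e0 r.
  (* [b - a] modulo [p], made nonnegative by adding [a * p]. *)
  have [a [b fe0]] := linked_all f; pose c := (b + a * p.-1)%N.
  exists (c %% p)%N; first by rewrite ltn_mod.
  apply: (@tied_trans _ _ _ e0 c); last first.
    rewrite [X in tied _ X](divn_eq c p) -[X in tied _ _ _ X]add0n.
    exact/tied_shift.
  apply: (proj1 (tied_shift R y a f 0 e0 c)); rewrite add0n; apply: tied_trans fe0 _.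
  have -> : (c + a = a * p + b)%N by rewrite /c; nia.
  by apply/tied_sym; rewrite -[X in tied _ _ _ X]add0n; exact/tied_shift.
have [r infB] : exists r, infinite_set [set f | tied f 0 e0 r].
  apply: contrapT => nr; apply: infinite_oedges.
  apply: (@sub_finite_set _ _ (\bigcup_(r in `I_p) [set f | tied f 0 e0 r])).
    by move=> f _; have [r rp fr] := red f; exists r.
  apply: bigcup_finite => // r _; apply: contrapT => rB; by apply: nr; exists r.
apply: e0_nnull; rewrite /null -(cvg_shiftn r (hit ^~ e0)).
apply: (@asym_null _ _ _ _ (fun f n => hit (n + 0) f) (deg y)%:R infB).
- by move=> f /tied_sym.
- by move=> n; exact: hit_ge0.
- by move=> F n; exact: sum_hit_le.
Qed.
End NotNull.

Lemma nbrw_infinite x : (fun n => nbrw R n x y) @ \oo --> (0 : R).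
Proof.
by apply: nbrw_cvg => // e _; apply: contrapT; exact: nonnull_absurd.
Qed.
End Infinite.

Theorem theorem1p2 (R : realType) (X : multigraph)
    (X_lf : locally_finite_graph X) (X_conn : connected_graph X)
    (X_deg : forall x : X, (2 <= deg x)%N) :
  [/\ (* (a) *)
      finite_set [set: X] ->
        forall x y : X,
          (fun n : nat => n%:R^-1 * \sum_(1 <= k < n.+1) nbrw R k x y) @ \oo
            --> ((deg y)%:R / (num_oedges X)%:R : R),
      (* (b) *)
      finite_set [set: X] -> (forall x : X, (3 <= deg x)%N) ->
        forall x y : X,
          (~ bipartite_graph X ->
             (fun n : nat => nbrw R n x y) @ \oo
               --> ((deg y)%:R / (num_oedges X)%:R : R)) /\
          (bipartite_graph X ->
             (fun n : nat => nbrw R (2 * n + odd (gdist x y))%N x y) @ \oo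
               --> (2 * (deg y)%:R / (num_oedges X)%:R : R))
    & (* (c) *)
      infinite_set [set: X] ->
        forall x y : X,
          (fun n : nat => nbrw R n x y) @ \oo --> (0 : R) ].
Proof.
split.
- by move=> X_fin x y; exact: mean_nbrw_cvg.
- move=> X_fin X_deg3 x y; split=> bip.
    exact: nbrw_nonbipartite.
  exact: nbrw_bipartite.
- by move=> X_inf x y; exact: nbrw_infinite.
Qed.
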